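(* Let $A\in\mathrm{GL}_2(\mathbb{Z})$ have real eigenvalues different from $\pm1$, let $n_0\in\mathbb{Z}^2$, and let $E=(\mathbb{Z}^2\rtimes_{-I}\mathbb{Z})\rtimes_\psi\mathbb{Z}$, where $\psi$ is the automorphism of $\mathbb{Z}^2\rtimes_{-I}\mathbb{Z}$ given by $\psi(zt^k)=A(z)(n_0t)^k$ for $z\in\mathbb{Z}^2$, $k\in\mathbb{Z}$ (so $\psi|_{\mathbb{Z}^2}=A$). Then the Reidemeister spectrum of $E$ is either $\{\infty\}$ or $\{8,\infty\}$. Moreover, if $\mathbb{Z}^2\rtimes_A\mathbb{Z}$ has the $R_\infty$ property, then so does $E$.
   Context: For $B\in\mathrm{GL}_2(\mathbb{Z})$, $\mathbb{Z}^2\rtimes_B\mathbb{Z}$ denotes the semidirect product in which a generator of $\mathbb{Z}$ acts on $\mathbb{Z}^2$ by multiplication by $B$; in $\mathbb{Z}^2\rtimes_{-I}\mathbb{Z}$ this generator is denoted $t$. For a group $G$ and $\psi\in\mathrm{Aut}(G)$, $G\rtimes_\psi\mathbb{Z}$ denotes the semidirect product in which a generator $u$ of $\mathbb{Z}$ acts on $G$ via $\psi$. For a group $G$ and an endomorphism $\varphi$ of $G$, say $x\sim_\varphi y$ if there is $z\in G$ with $x=zy\varphi(z)^{-1}$; the Reidemeister number $R(\varphi)$ is the number of equivalence classes of $\sim_\varphi$ ($\infty$ if infinite). The Reidemeister spectrum of $G$ is $\mathrm{Spec}_R(G)=\{R(\varphi)\mid \varphi\in\mathrm{Aut}(G)\}$,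 and $G$ has the $R_\infty$ property if $\mathrm{Spec}_R(G)=\{\infty\}$. *)

(* Defs.v *)
From HB Require Import structures.
From mathcomp Require Import all_boot all_order all_algebra all_field.
From mathcomp Require Import boolp classical_sets functions cardinality.
From mathcomp Require Import finmap zify.

Set Implicit Arguments.
Unset Strict Implicit.
Unset Printing Implicit Defensive.

Import GRing.Theory.

Local Open Scope group_scope.

Definition expgz (G : groupType) (x : G) (k : int) : G :=
  match k with Posz n => x ^+ n | Negz n => x ^- n.+1 end.

Section ExpgzTheory.
Variable G : groupType.
Implicit Type x : G.

Lemma expgzS x k : expgz x (k + 1)%R = expgz x k * x.
Proof.
case: k => [n|[|n]].
- have -> : (Posz n + 1 = Posz n.+1)%R by lia.
  by rewrite /= expgSr.
- by rewrite /= expg1 mulVg.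
- have -> : (Negz n.+1 + 1 = Negz n)%R by rewrite !NegzE; lia.
  by rewrite /= [in RHS]expgS invgM mulgVK.
Qed.

Lemma expgzD x m n : expgz x (m + n)%R = expgz x m * expgz x n.
Proof.
elim/int_rec: n => [|n IHn|n IHn]; first by rewrite addr0 mulg1.
- by rewrite -addn1 PoszD addrA !expgzS IHn mulgA.
- apply: (@mulIg _ x); rewrite -mulgA -!expgzS -addrA.
  have -> : (- n.+1%:Z + 1 = - n%:Z)%R by lia.
  exact: IHn.
Qed.

End ExpgzTheory.

Record aut (G : groupType) := Aut {
  aut_fun :> G -> G;
  autM : {morph aut_fun : x y / x * y};
  aut_bij : bijective aut_fun
}.

Section AutGroup.
Variable G : groupType.
Implicit Types f g h : aut G.

Lemma autP f g : f =1 g -> f = g.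
Proof.
case: f g => [f fM fB] [g gM gB] /= /funext fg; case: g / fg gM gB => gM gB.
by congr Aut; exact: Prop_irrelevance.
Qed.

Definition aut_one : aut G :=
  @Aut G id (fun _ _ => erefl) (Bijective (fun _ => erefl) (fun _ => erefl)).

Lemma aut_mul_morph f g : {morph f \o g : x y / x * y}.
Proof. by move=> x y /=; rewrite !autM. Qed.

Definition aut_mul f g : aut G :=
  Aut (@aut_mul_morph f g) (bij_comp (aut_bij f) (aut_bij g)).

Lemma aut_inv_subproof f : {g : aut G | cancel f g /\ cancel g f}.
Proof.
apply: cid; have [g fK gK] := aut_bij f.
have gM : {morph g : x y / x * y}.
  by move=> x y; apply: (can_inj fK); rewrite autM !gK.
by exists (Aut gM (Bijective gK fK)).
Qed.

Definition aut_inv f : aut G := sval (aut_inv_subproof f).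

Lemma aut_invK f : cancel f (aut_inv f).
Proof. by rewrite /aut_inv; case: (aut_inv_subproof f) => g []. Qed.

Lemma autK_inv f : cancel (aut_inv f) f.
Proof. by rewrite /aut_inv; case: (aut_inv_subproof f) => g []. Qed.

HB.instance Definition _ := gen_eqMixin (aut G).
HB.instance Definition _ := gen_choiceMixin (aut G).

Fact aut_mulA : associative aut_mul. Proof. by move=> f g h; exact: autP. Qed.
Fact aut_mul1 : left_id aut_one aut_mul. Proof. by move=> f; exact: autP. Qed.
Fact aut_1mul : right_id aut_one aut_mul. Proof. by move=> f; exact: autP. Qed.
Fact aut_mulV : left_inverse aut_one aut_inv aut_mul.
Proof. by move=> f; apply: autP => x /=; exact: aut_invK. Qed.
Fact aut_mulgV : right_inverse aut_one aut_inv aut_mul.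
Proof. by move=> f; apply: autP => x /=; exact: autK_inv. Qed.

HB.instance Definition _ :=
  isGroup.Build (aut G) aut_mulA aut_mul1 aut_1mul aut_mulV aut_mulgV.

End AutGroup.

(* [sdZ psi] is the semidirect product of G by Z; the pair (g, k) stands for *)
(* g u^k, where the generator u of Z satisfies u g u^-1 = psi g. *)
Definition sdZ (G : groupType) (psi : aut G) : Type := (G * int)%type.

Section SemidirectZ.
Variables (G : groupType) (psi : aut G).
Local Notation S := (sdZ psi).

HB.instance Definition _ := Choice.copy S (G * int)%type.

Definition sdZ_mul (x y : S) : S :=
  (x.1 * expgz psi x.2 y.1, (x.2 + y.2)%R).
Definition sdZ_one : S := (1, 0%R).
Definition sdZ_inv (x : S) : S := (expgz psi (- x.2)%R x.1^-1, (- x.2)%R).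

Lemma aut1 (f : aut G) : f 1 = 1.
Proof. by apply: (@mulgI _ (f 1)); rewrite -autM !mulg1. Qed.

Fact sdZ_mulA : associative sdZ_mul.
Proof.
move=> x y z; rewrite /sdZ_mul /= addrA; congr pair.
by rewrite expgzD autM mulgA.
Qed.
Fact sdZ_mul1 : left_id sdZ_one sdZ_mul.
Proof. by case=> g k; rewrite /sdZ_mul /= mul1g add0r. Qed.
Fact sdZ_1mul : right_id sdZ_one sdZ_mul.
Proof. by case=> g k; rewrite /sdZ_mul /= aut1 mulg1 addr0. Qed.
Fact sdZ_mulV : left_inverse sdZ_one sdZ_inv sdZ_mul.
Proof.
by case=> g k; rewrite /sdZ_mul /= -autM mulVg aut1 addNr.
Qed.
Fact sdZ_mulgV : right_inverse sdZ_one sdZ_inv sdZ_mul.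
Proof.
case=> g k; rewrite /sdZ_mul /= addrN; congr pair.
have -> : expgz psi k (expgz psi (- k)%R g^-1) = g^-1.
  rewrite -[LHS]/((expgz psi k * expgz psi (- k)%R) g^-1).
  by rewrite -expgzD addrN.
by rewrite mulgV.
Qed.

HB.instance Definition _ :=
  isGroup.Build S sdZ_mulA sdZ_mul1 sdZ_1mul sdZ_mulV sdZ_mulgV.

Definition sdZ_base (g : G) : S := (g, 0%R).
Definition sdZ_gen : S := (1, 1%R).

End SemidirectZ.

(* The additive group of integer column vectors, written multiplicatively. *)
Notation Z2 := (Algebra.to_multiplicative 'cV[int]_2).

Section MatrixAut.
Variables (B : 'M[int]_2) (uB : B \in unitmx).

Fact mx_aut_morph : {morph (fun z : Z2 => (B *m z)%R : Z2) : x y / x * y}.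
Proof. by move=> x y; exact: mulmxDr. Qed.
Fact mx_aut_bij : bijective (fun z : Z2 => (B *m z)%R : Z2).
Proof. by exists (mulmx (invmx B)) => z; rewrite ?mulKmx ?mulKVmx. Qed.

Definition mx_aut : aut Z2 := Aut mx_aut_morph mx_aut_bij.

End MatrixAut.

Fact unitmx_N1 : (- 1%:M)%R \in @unitmx int 2.
Proof. by rewrite -scaleN1r unitmxZ ?unitmx1 // unitrN unitr1. Qed.

Notation Z2xN1 := (sdZ (mx_aut unitmx_N1)).

Section Psi.
Variables (A : 'M[int]_2) (uA : A \in unitmx) (n0 : Z2).

(* psi (z t^k) = A z (n0 t)^k, where t = sdZ_gen *)
Definition psi_fun (x : Z2xN1) : Z2xN1 :=
  sdZ_base _ (mx_aut uA x.1) * expgz (sdZ_base _ n0 * sdZ_gen _) x.2.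

Let s : Z2xN1 := sdZ_base _ n0 * sdZ_gen _.

Lemma sdZ_baseM (G : groupType) (f : aut G) :
  {morph sdZ_base f : x y / x * y}.
Proof. by move=> x y; rewrite /sdZ_base; congr pair. Qed.

Lemma expgz_s2 k : (expgz s k).2 = k.
Proof.
elim/int_rec: k => // n IHn.
- have -> : (n.+1%:Z = n%:Z + 1)%R by lia.
  by rewrite expgzS /= IHn add0r.
- have := expgzS s (- n.+1%:Z)%R.
  have -> : (- n.+1%:Z + 1 = - n%:Z)%R by lia.
  by move/(congr1 snd); rewrite /= IHn; lia.
Qed.

(* Any power of s acts on Z2 as the corresponding power of -I. *)
Lemma expgz_sJ k (z : Z2) :
  expgz s k * sdZ_base _ z
    = sdZ_base _ (expgz (mx_aut unitmx_N1) k z) * expgz s k.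
Proof.
rewrite [expgz s k]surjective_pairing expgz_s2; congr pair => /=.
- exact: addrC.
- by rewrite addr0 add0r.
Qed.

Lemma N1_comm k :
  commute (mx_aut uA) (expgz (mx_aut unitmx_N1) k).
Proof.
have H : commute (mx_aut uA) (mx_aut unitmx_N1).
  by apply: autP => w /=; rewrite !mulNmx !mul1mx mulmxN.
by case: k => n; [exact: commuteX | apply: commuteV; exact: commuteX].
Qed.

Fact psi_morph : {morph psi_fun : x y / x * y}.
Proof.
move=> x y; rewrite /psi_fun -/s expgzD.
rewrite -[in RHS]mulgA [in RHS](mulgA (expgz s _)) expgz_sJ.
rewrite -!mulgA !mulgA; congr (_ * _ * _); rewrite -sdZ_baseM; congr sdZ_base.
by rewrite [in LHS]autM; congr (_ * _);
  exact: (congr1 (@^~ y.1) (congr1 (@aut_fun _) (N1_comm x.2))).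
Qed.

Fact psi_bij : bijective psi_fun.
Proof.
pose psi' (x : Z2xN1) : Z2xN1 :=
  ((invmx A *m (x.1 - (expgz s x.2).1 : 'cV[int]_2))%R, x.2).
have E x : psi_fun x = ((A *m x.1 + (expgz s x.2).1)%R, x.2).
  rewrite /psi_fun -/s; congr pair; rewrite /= ?expgz_s2 ?add0r //.
exists psi' => -[z k].
- by rewrite E /psi' /= addrK mulKmx.
- by rewrite E /psi' /= mulKVmx // subrK.
Qed.

Definition psi : aut Z2xN1 := Aut psi_morph psi_bij.

End Psi.

Section Reidemeister.
Variable G : groupType.

Definition reidemeister_rel (phi : G -> G) (x y : G) : Prop :=
  exists z : G, x = z * y * (phi z)^-1.

Definition reidemeister_classes (phi : G -> G) : set (set G) :=
  [set [set x | reidemeister_rel phi x y] | y in [set: G]]%classic.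

Inductive enat := Fin of nat | Infty.

Definition reidemeister_number (phi : G -> G) : enat :=
  if `[< finite_set (reidemeister_classes phi) >]
  then Fin #|` fset_set (reidemeister_classes phi)|%fset
  else Infty.

Definition reidemeister_spectrum : set enat :=
  [set reidemeister_number phi | phi in [set: aut G]]%classic.

Definition R_infty : Prop := reidemeister_spectrum = [set Infty]%classic.

End Reidemeister.

Arguments reidemeister_spectrum : clear implicits.
Arguments R_infty : clear implicits.

(* Main.v *)
(* An automorphism phi of E preserves Z^2, the isolator of [E, E], and acts
   there by some M in GL_2(Z). Since no nontrivial power of A is +-I, phi acts on
   E / Z^2 = <t, u> by t |-> a t, u |-> e t + f u with a, f = +-1. If a or f
   equals 1, then phi fixes a nonzero functional of E / Z^2 and R(phi) is
   infinite. If a = f = -1, the classes of phi lie over the four cosets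
   represented by t^j u^k (j, k = 0, 1), and those over t^j u^k correspond to the
   cokernel of I - (-1)^j A^k M. The relation M A M^-1 = (-1)^e A^-1 forces
   (-1)^e = det A and tr M = tr (A M) = 0, so det (I -+ M) = 1 + det M and
   det (I -+ A M) = 1 + det (A M) lie in {0, 2}: R(phi) is infinite, or
   4 * 2 = 8. The value 8 requires M A M^-1 = A^-1, and then
   z s^k |-> M z s^-k is an automorphism of the semidirect product of Z^2 and
   <s> = Z via A whose Reidemeister number is finite for the same reason. *)
Require Import Defs.
From HB Require Import structures.
From mathcomp Require Import all_boot all_order all_algebra all_field.
From mathcomp Require Import boolp classical_sets functions cardinality finmap.
From mathcomp Require Import zify ring.

Set Implicit Arguments.
Unset Strict Implicit.
Unset Printing Implicit Defensive.

Import Order.TTheory GRing.Theory Num.Theory.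

(** * Reidemeister classes *)

Section ReidemeisterCounting.
Local Open Scope group_scope.
Variables (G : groupType) (phi : aut G).
Implicit Types x y z : G.

Lemma autV (f : aut G) x : f x^-1 = (f x)^-1.
Proof. by apply/esym/mulg1_eq; rewrite -autM mulgV aut1. Qed.

Lemma reidemeister_rel_refl x : reidemeister_rel phi x x.
Proof. by exists 1; rewrite mul1g aut1 invg1 mulg1. Qed.

Lemma reidemeister_rel_sym x y :
  reidemeister_rel phi x y -> reidemeister_rel phi y x.
Proof. by case=> z ->; exists z^-1; rewrite autV invgK !mulgA mulVg mul1g mulgVK. Qed.

Lemma reidemeister_rel_trans x y z :
  reidemeister_rel phi x y -> reidemeister_rel phi y z -> reidemeister_rel phi x z.
Proof. by case=> a -> [b ->]; exists (a * b); rewrite autM invgM !mulgA. Qed.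

Let class y := [set x | reidemeister_rel phi x y]%classic.

Lemma reidemeister_class_eq x y : class x = class y <-> reidemeister_rel phi x y.
Proof.
split=> [E|xy].
  by rewrite -[reidemeister_rel phi x y]/(class y x) -E; exact: reidemeister_rel_refl.
apply/seteqP; split=> z /= zx; first exact: reidemeister_rel_trans zx xy.
exact: reidemeister_rel_trans zx (reidemeister_rel_sym xy).
Qed.

Lemma reidemeister_infinite (g : nat -> G) :
  (forall m n, reidemeister_rel phi (g m) (g n) -> m = n) ->
  reidemeister_number phi = Infty.
Proof.
move=> g_inj; rewrite /reidemeister_number; case: asboolP => // fin.
have cg_inj : injective (class \o g).
  by move=> m n /reidemeister_class_eq; exact: g_inj.
have := finite_preimage (in2W cg_inj) fin.
have -> : ((class \o g) @^-1` reidemeister_classes phi = setT)%classic.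
  by apply/seteqP; split=> // n _; exists (g n).
by move=> /infinite_nat.
Qed.

Section Representatives.
Variables (T : finType) (r : T -> G).
Hypothesis r_cover : forall x, exists t, reidemeister_rel phi x (r t).

(** The ordinal index lets [reidemeister_card] compare the set of classes with an initial segment of
    the naturals. *)
Lemma reidemeister_classes_rep :
  reidemeister_classes phi = [set class (r (enum_val i)) | i in [set: 'I_#|T|]]%classic.
Proof.
apply/seteqP; split=> _ [x _ <-]; last by exists (r (enum_val x)).
have [t xt] := r_cover x; exists (enum_rank t) => //; rewrite enum_rankK.
exact/reidemeister_class_eq/reidemeister_rel_sym.
Qed.

Lemma reidemeister_classes_finite : finite_set (reidemeister_classes phi).
Proof.
by rewrite reidemeister_classes_rep; apply/finite_image/finite_finset.
Qed.

Lemma reidemeister_finite : reidemeister_number phi <> Infty.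
Proof.
rewrite /reidemeister_number; case: asboolP => // -[].
exact: reidemeister_classes_finite.
Qed.

Lemma reidemeister_card :
  (forall t t', reidemeister_rel phi (r t) (r t') -> t = t') ->
  reidemeister_number phi = Fin #|T|.
Proof.
move=> r_inj; rewrite /reidemeister_number asboolT; last exact: reidemeister_classes_finite.
congr Fin; apply: card_fset_set; rewrite reidemeister_classes_rep.
apply: card_eq_trans (inj_card_eq _) _; last by rewrite card_eq_sym card_II.
by move=> i j _ _ /reidemeister_class_eq /r_inj /enum_val_inj.
Qed.

End Representatives.
End ReidemeisterCounting.

Local Open Scope ring_scope.

(** * Integral matrices of size two *)

Section TwoByTwo.
Variable R : comNzRingType.
Implicit Types A B M N : 'M[R]_2.

Lemma ord2_ind (P : 'I_2 -> Prop) : P 0 -> P 1 -> forall i, P i.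
Proof.
by move=> P0 P1 [[|[|//]] lti];
  [move: P0 | move: P1]; congr P; apply: val_inj.
Qed.

Lemma mx22P A B :
  [/\ A 0 0 = B 0 0, A 0 1 = B 0 1, A 1 0 = B 1 0 & A 1 1 = B 1 1] -> A = B.
Proof.
by move=> [? ? ? ?]; apply/matrixP; elim/ord2_ind; elim/ord2_ind.
Qed.

Lemma sum_ord2 (V : nmodType) (F : 'I_2 -> V) : \sum_i F i = F 0 + F 1.
Proof.
by rewrite big_ord_recl big_ord1; congr (_ + F _); apply: val_inj.
Qed.

Lemma mxtrace22 A : \tr A = A 0 0 + A 1 1.
Proof. exact: sum_ord2. Qed.

Lemma mulmx22E (n : nat) A (B : 'M_(2, n)) i j :
  (A *m B) i j = A i 0 * B 0 j + A i 1 * B 1 j.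
Proof. by rewrite mxE sum_ord2. Qed.

Lemma det_mx22 A : \det A = A 0 0 * A 1 1 - A 0 1 * A 1 0.
Proof.
rewrite (expand_det_row _ 0) sum_ord2 /cofactor !det_mx11 !mxE /= expr0 expr1.
rewrite mul1r mulN1r mulrN.
by congr (_ * A _ _ - _ * A _ _); apply: val_inj.
Qed.

(** Cayley-Hamilton in size two. *)
Lemma mxtrace_det_mulmx A : A *m A = \tr A *: A - (\det A)%:M.
Proof.
apply: mx22P; rewrite det_mx22 mxtrace22 !mulmx22E !mxE /= !mulr0n !mulr1n.
by split; ring.
Qed.

Lemma det_scalar_sub a A : \det (a%:M - A) = a ^+ 2 - a * \tr A + \det A.
Proof.
by rewrite !det_mx22 mxtrace22 !mxE /= !mulr0n !mulr1n; ring.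
Qed.

(** In size two, [\tr A *: 1%:M - A] is the adjugate of [A]. *)
Lemma mulmx_mxtrace_sub A : (\tr A *: 1%:M - A) *m A = (\det A)%:M.
Proof. by rewrite mulmxBl -scalemxAl mul1mx mxtrace_det_mulmx opprB addrC subrK. Qed.

End TwoByTwo.

(** Write t, d for the trace and determinant of A. The traces of M A = adj(A) M and of A times this
    relation give 2 tr(AM) = t tr M and 2 tr(AAM) = t tr(AM). Cayley-Hamilton turns the latter into
    t tr(AM) = 2 d tr M, so (t^2 - 4d) tr M = 0. *)
Lemma mxtrace_eq0_of_reverse (A M : 'M[int]_2) :
    (\tr A) ^+ 2 != 4 * \det A ->
    M *m A = (\tr A *: 1%:M - A) *m M ->
  \tr M = 0 /\ \tr (A *m M) = 0.
Proof.
move=> disc MA.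
have H1 : \tr (A *m M) + \tr (A *m M) = \tr A * \tr M.
  have /(congr1 mxtrace) := MA.
  rewrite mxtrace_mulC mulmxBl -scalemxAl mul1mx raddfB /= mxtraceZ => {1}->.
  by rewrite subrK.
have H2 : \tr (A *m A *m M) + \tr (A *m A *m M) = \tr A * \tr (A *m M).
  have /(congr1 (mulmx A)) /(congr1 mxtrace) := MA.
  rewrite mulmxBl -scalemxAl mul1mx mulmxBr raddfB /= -scalemxAr mxtraceZ.
  by rewrite mulmxA mxtrace_mulC !mulmxA => {1}->; rewrite subrK.
move: H2; rewrite mxtrace_det_mulmx mulmxBl -scalemxAl mul_scalar_mx.
rewrite raddfB /= !mxtraceZ.
set t := \tr A in disc H1 *; set d := \det A in disc *.
move: H1; set x := \tr M; set y := \tr (A *m M) => H1 H2.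
have : (t ^+ 2 - 4 * d) * x = 0 by nia.
by move/eqP; rewrite mulf_eq0 subr_eq0 (negPf disc) /= => /eqP x0; split=> //; nia.
Qed.

Definition oddz (x : int) := odd `|x|%N.

Lemma oddzM x y : oddz (x * y) = oddz x && oddz y.
Proof. by rewrite /oddz abszM oddM. Qed.

Lemma oddzB x y : oddz (x - y) = oddz x (+) oddz y.
Proof. by rewrite /oddz; lia. Qed.

Lemma oddz_double x : oddz x = false -> exists y, x = 2 * y.
Proof.
move=> ex; exists (x %/ 2)%Z.
by move: ex; rewrite /oddz; lia.
Qed.

(* D y = u is solvable iff adj(D) u is divisible by 2; modulo 2 the matrix
   adj(D) has rank one, so the solvable u form a subgroup of index 2. *)
Lemma det2_coker (D : 'M[int]_2) : \det D = 2 ->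
  exists w : bool -> 'cV[int]_2,
    (forall v, exists t y, v = w t + D *m y) /\
    (forall t t' y, w t = w t' + D *m y -> t = t').
Proof.
rewrite det_mx22 => detD.
(* [P u] and [Q u] are the parities of the two coordinates of adj(D) u. *)
pose P (u : 'cV[int]_2) := oddz (D 1 1 * u 0 0 - D 0 1 * u 1 0).
pose Q (u : 'cV[int]_2) := oddz (D 0 0 * u 1 0 - D 1 0 * u 0 0).
have solve u : P u = false -> Q u = false -> exists y, u = D *m y.
  move=> /oddz_double [y0 E0] /oddz_double [y1 E1].
  exists (\col_i (if i == 0 then y0 else y1)).
  apply/matrixP => i j; rewrite (ord1 j) mulmx22E !mxE /=.
  apply: (@mulfI _ 2) => //.
  elim/ord2_ind: i => /=; rewrite mulrDr !(mulrCA 2) -E0 -E1 -{1}detD; ring.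
have Peven y : P (D *m y) = false.
  rewrite /P !mulmx22E.
  have -> : D 1 1 * (D 0 0 * y 0 0 + D 0 1 * y 1 0)
      - D 0 1 * (D 1 0 * y 0 0 + D 1 1 * y 1 0) = 2 * y 0 0.
    by rewrite -detD; ring.
  by rewrite oddzM.
have Qeven y : Q (D *m y) = false.
  rewrite /Q !mulmx22E.
  have -> : D 0 0 * (D 1 0 * y 0 0 + D 1 1 * y 1 0)
      - D 1 0 * (D 0 0 * y 0 0 + D 0 1 * y 1 0) = 2 * y 1 0.
    by rewrite -detD; ring.
  by rewrite oddzM.
have PB u v : P (u - v) = P u (+) P v.
  by rewrite /P !mxE -oddzB; congr oddz; ring.
have QB u v : Q (u - v) = Q u (+) Q v.
  by rewrite /Q !mxE -oddzB; congr oddz; ring.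
have rank_le1 : oddz (D 0 0) && oddz (D 1 1) = oddz (D 0 1) && oddz (D 1 0).
  have : oddz (D 0 0 * D 1 1 - D 0 1 * D 1 0) = false by rewrite detD.
  by rewrite oddzB !oddzM => /negbT; rewrite negb_add => /eqP.
(* If all entries were even, 4 would divide the determinant 2. *)
have rank_ge1 : [|| oddz (D 0 0), oddz (D 1 1), oddz (D 0 1) | oddz (D 1 0)].
  apply/negPn/negP; rewrite !negb_or => /and4P[].
  move=> /negbTE/oddz_double [a Ea] /negbTE/oddz_double [d Ed].
  move=> /negbTE/oddz_double [b Eb] /negbTE/oddz_double [c Ec].
  have : 4 * (a * d - b * c) = 2 by rewrite -detD Ea Eb Ec Ed; ring.
  move: (a * d - b * c) => m; lia.
(* The basis vector [e] selects a column of adj(D) that is nonzero modulo 2: the first one if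
   possible, otherwise the second. *)
pose e : 'cV[int]_2 :=
  \col_i (i == ~~ (oddz (D 1 1) || oddz (D 1 0)) :> nat)%:R.
have [Pe Qe] : P e = (if oddz (D 1 1) || oddz (D 1 0) then oddz (D 1 1) else oddz (D 0 1))
   /\ Q e = (if oddz (D 1 1) || oddz (D 1 0) then oddz (D 1 0) else oddz (D 0 0)).
  rewrite /P /Q !mxE /=; case: ifP => _ /=;
  by rewrite ?mulr0 ?mulr1 ?subr0 ?sub0r /oddz ?abszN.
have e_gen v : (P v || Q v -> P v = P e /\ Q v = Q e) /\ (P e || Q e).
  rewrite Pe Qe /P /Q !oddzB !oddzM.
  by move: rank_le1 rank_ge1; do 4 case: (oddz (D _ _)); do 2 case: (oddz (v _ _)).
exists (fun t => if t then e else 0); split.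
  move=> v; exists (P v || Q v).
  suff [y Ey] : exists y, v - (if P v || Q v then e else 0) = D *m y.
    by exists y; rewrite -Ey addrC subrK.
  have [ve _] := e_gen v; case: ifP ve => [_ [//|Pv Qv]|/norP [Pv Qv] _].
    by apply: solve; rewrite ?PB ?QB ?Pv ?Qv addbb.
  by rewrite subr0; apply: solve; apply/negbTE.
have [_ /negP e_odd] := e_gen 0.
have Ne y : e <> D *m y by move=> E; apply: e_odd; rewrite E Peven Qeven.
case=> -[] y //; rewrite ?add0r ?addr0 => E; first by case: (Ne y).
by case: (Ne (- y)); rewrite mulmxN; apply/eqP; rewrite -subr_eq0 opprK -E.
Qed.

(** * Consequences of the eigenvalue hypothesis on A *)

Section Spectrum.
Variable A : 'M[int]_2.
Local Notation AC := (map_mx (intr : int -> algC) A).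
Hypothesis hA : forall a : algC, eigenvalue AC a ->
  [/\ a \is Num.real, a != 1 & a != -1].

Lemma det_scalar_sub_neq0 (a : int) : a ^+ 2 = 1 -> \det (a%:M - A) != 0.
Proof.
move=> a2; apply/eqP => det0.
have /det0P [v v0 Ev] : \det ((a%:~R)%:M - AC) == 0.
  by rewrite -map_scalar_mx -map_mxB det_map_mx det0.
have /hA [_] : eigenvalue AC a%:~R.
  apply/eigenvalueP; exists v => //.
  by move/eqP: Ev; rewrite mulmxBr mul_mx_scalar subr_eq0 => /eqP.
have : (a - 1) * (a + 1) = 0 by rewrite -[RHS](subrr (a ^+ 2)) {2}a2; ring.
move/eqP; rewrite mulf_eq0 subr_eq0 addr_eq0 => /orP [] /eqP ->.
  by rewrite eqxx.
by rewrite rmorphN1 eqxx.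
Qed.

(** Otherwise an eigenvalue of [A] would be a real root of unity, hence 1 or -1. *)
Lemma expmx_neq1 n : (0 < n)%N -> A ^+ n != 1.
Proof.
move=> n0; apply/eqP => An.
have [a ea] := @eigenvalue_closed algC 2 AC isT.
have [aR a1 aN1] := hA ea; have /eigenvalueP [v Ev v0] := ea.
have Evk k : v *m AC ^+ k = a ^+ k *: v.
  elim: k => [|k IHk]; first by rewrite !expr0 mulmx1 scale1r.
  by rewrite !exprSr mulmxA IHk -scalemxAl Ev scalerA.
have an1 : a ^+ n = 1.
  move: (Evk n); rewrite -rmorphXn /= An rmorph1 mulmx1 => /eqP.
  rewrite -subr_eq0 -{1}[v]scale1r -scalerBl scaler_eq0 (negPf v0) orbF.
  by rewrite subr_eq0 => /eqP.
(* As [a] is real, its square is nonnegative, and a nonnegative root of unity is 1. *)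
have : (a ^+ 2) ^+ n == 1 by rewrite exprAC an1 expr1n.
rewrite pexpr_eq1 ?real_exprn_even_ge0 //.
by rewrite sqrf_eq1 (negPf a1) (negPf aN1).
Qed.

Lemma expmx_neq_sign n (s : int) : (0 < n)%N -> s ^+ 2 = 1 -> A ^+ n != s%:M.
Proof.
move=> n0 s2; apply/eqP => An.
have /eqP[] : A ^+ (n * 2) != 1 by apply: expmx_neq1; rewrite muln_gt0 n0.
by rewrite exprM An -rmorphXn s2 rmorph1.
Qed.

Hypothesis uA : A \in unitmx.

Lemma det_unitmx : \det A = 1 \/ \det A = -1.
Proof. by move: uA; rewrite unitmxE => /orP [] /eqP; [left | right]. Qed.

(** With trace 0, Cayley-Hamilton would make the square of [A] equal to I or -I. *)
Lemma mxtrace_neq0 : \tr A != 0.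
Proof.
apply/eqP => tr0.
have : A ^+ 2 = (- \det A)%:M.
  by rewrite expr2 [LHS]mxtrace_det_mulmx tr0 scale0r sub0r -raddfN.
apply/eqP/expmx_neq_sign => //.
by case: det_unitmx => ->.
Qed.

(** Equality forces determinant 1 and trace 2 or -2, which makes 1 or -1 an eigenvalue. *)
Lemma discriminant_neq0 : \tr A ^+ 2 != 4 * \det A.
Proof.
have := @det_scalar_sub_neq0 1 erefl; have := @det_scalar_sub_neq0 (-1) erefl.
rewrite !det_scalar_sub; move: (\tr A) => t.
case: det_unitmx => -> tN1 t1; apply/eqP => disc; last first.
  by have := sqr_ge0 t; rewrite disc.
have : (t - 2) * (t + 2) = 0 by rewrite -[RHS](subrr (t ^+ 2)) {2}disc; ring.
move/eqP; rewrite mulf_eq0 subr_eq0 addr_eq0 => /orP [] /eqP tE.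
  by rewrite tE in t1.
by rewrite tE in tN1.
Qed.

End Spectrum.

(** * Reidemeister classes of group extensions by Z^2 *)

Section Extension.
Variables (G : groupType) (Q : zmodType).
(** An extension of an abelian group Q by Z^2, with [rho] the conjugation action. It serves both for
    E, with Q = Z^2, and for the semidirect product via A, with Q = Z. *)
Variables (i : 'cV[int]_2 -> G) (p : G -> Q) (rho : Q -> 'cV[int]_2 -> 'cV[int]_2).
Hypothesis iD : forall v w, i (v + w) = (i v * i w)%g.
Hypothesis i_inj : injective i.
Hypothesis pM : forall x y, p (x * y)%g = p x + p y.
Hypothesis p_surj : forall q, exists x, p x = q.
Hypothesis ker_p : forall x, p x = 0 <-> exists v, x = i v.
Hypothesis conj_i : forall x v, (x * i v = i (rho (p x) v) * x)%g.

Variables (phi : aut G) (M : 'M[int]_2) (phib : Q -> Q).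
Hypothesis phi_i : forall v, phi (i v) = i (M *m v).
Hypothesis p_phi : forall x, p (phi x) = phib (p x).

Lemma extension_iN v : i (- v) = ((i v)^-1)%g.
Proof.
have i0 : i 0 = 1%g by apply: (@mulgI _ (i 0)); rewrite -iD mulg1 addr0.
by apply/esym/mulg1_eq; rewrite -iD subrr.
Qed.

Lemma extension_pV x : p x^-1%g = - p x.
Proof.
have p1 : p 1%g = 0 by apply: (@addrI _ (p 1%g)); rewrite -pM mulg1 addr0.
by apply/eqP; rewrite -addr_eq0 -pM mulVg p1.
Qed.

(** Twisted conjugation by Z^2 preserves the coset of [s] and translates it by the image of I -
    rho(p s) M; hence cokernels count the classes. *)
Lemma extension_twist s v y :
  (i y * (i v * s) * (phi (i y))^-1 = i (v + (y - rho (p s) (M *m y))) * s)%g.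
Proof.
have rhoN w : rho (p s) (- w) = - rho (p s) w.
  apply: i_inj; apply: (@mulIg _ s).
  rewrite -conj_i !extension_iN; apply: (@mulIg _ (i w)).
  by rewrite -mulgA mulVg mulg1 -[in RHS]mulgA conj_i mulKg.
by rewrite phi_i -extension_iN -!mulgA conj_i rhoN !mulgA -!iD addrA (addrC v).
Qed.

Let rel := reidemeister_rel phi.

Let pi u : p (i u) = 0. Proof. by apply/ker_p; exists u. Qed.

Lemma extension_rel_base x y :
  rel x y -> exists q, p x + phib q = p y + q.
Proof.
case=> z ->; exists (p z); rewrite !pM extension_pV p_phi subrK.
exact: addrC.
Qed.

(** An element relating two members of one coset projects to a fixed point of [phib], so it lies in
    Z^2 and [extension_twist] applies. *)
Lemma extension_rel_coset s v w : (forall q, phib q = q -> q = 0) ->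
  rel (i v * s)%g (i w * s)%g -> exists y, v = w + (y - rho (p s) (M *m y)).
Proof.
move=> phib_fix [z E].
have /ker_p [y Ez] : p z = 0.
  apply: phib_fix; have := congr1 p E; rewrite !pM extension_pV p_phi !pi !add0r.
  rewrite [p z + p s]addrC -addrA -[LHS]addr0 => /addrI /esym /eqP.
  by rewrite subr_eq0 => /eqP.
by exists y; apply: i_inj; apply: (@mulIg _ s); rewrite E Ez extension_twist.
Qed.

(** An invariant functional [h] composed with [p] is constant on each Reidemeister class, yet takes
    infinitely many values. *)
Lemma extension_infinite_base (h : Q -> int) (q : nat -> Q) :
    (forall a b, h (a + b) = h a + h b) -> (forall a, h (phib a) = h a) ->
    injective (h \o q) ->
  reidemeister_number phi = Infty.
Proof.
move=> hD h_phib hq_inj; have [g pg] := choice (fun n => p_surj (q n)).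
apply: (@reidemeister_infinite _ _ g) => m n /extension_rel_base [a].
by move/(congr1 h); rewrite !hD h_phib !pg => /addIr /hq_inj.
Qed.

(** Here N is an involution by Cayley-Hamilton, so I + N kills the image of I - N and separates the
    multiples of a vector that it does not kill. *)
Lemma extension_infinite_coset s (N : 'M[int]_2) :
    (forall q, phib q = q -> q = 0) ->
    (forall y, rho (p s) (M *m y) = N *m y) -> \tr N = 0 -> \det N = -1 ->
  reidemeister_number phi = Infty.
Proof.
move=> phib_fix NE trN detN.
have NN : (1%:M + N) *m (1%:M - N) = 0.
  rewrite mulmxBr mulmx1 mulmxDl mul1mx mxtrace_det_mulmx trN detN scale0r.
  by rewrite sub0r raddfN opprK [N + _]addrC subrr.
(* The trace of I + N is 2, so some column is nonzero. *)
have [j Nj] : exists j, col j (1%:M + N) != 0.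
  apply/not_existsP => N0.
  have /eqP : \tr (1%:M + N) = 0.
    rewrite mxtrace22; have /colP/(_ 0) := contra_notP (fun H => introN eqP H) (N0 0).
    have /colP/(_ 1) := contra_notP (fun H => introN eqP H) (N0 1).
    by rewrite ![col _ _ _ _]mxE => -> ->; rewrite !mxE.
  by rewrite raddfD /= trN mxtrace1.
pose e : 'cV[int]_2 := delta_mx j 0.
apply: (@reidemeister_infinite _ _ (fun n => (i (n%:R *: e) * s)%g)) => m n.
move=> /(extension_rel_coset phib_fix) [y].
rewrite NE -[y in y - _]mul1mx -mulmxBl => /(congr1 (mulmx (1%:M + N))).
rewrite mulmxDr mulmxA NN mul0mx addr0 -!scalemxAr -colE => /eqP.
rewrite -subr_eq0 -scalerBl scalemx_eq0 (negPf Nj) orbF subr_eq0.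
by rewrite eqr_nat => /eqP.
Qed.

Section FiniteCokernel.
Variables (J : finType) (s : J -> G) (N : J -> 'M[int]_2).
Hypothesis s_cover : forall q, exists j q', q = p (s j) + q' - phib q'.
Hypothesis NE : forall j y, rho (p (s j)) (M *m y) = N j *m y.
Hypothesis detN : forall j, \det (1%:M - N j) = 2.

(** [J] indexes the twisted classes of the quotient, and the boolean the two elements of each
    cokernel. Separation is conditional because finiteness follows from covering alone. *)
Lemma extension_representatives : exists r : J * bool -> G,
  (forall x, exists t, rel x (r t)) /\
  ((forall q, phib q = q -> q = 0) ->
   (forall j j' q, p (s j) + phib q = p (s j') + q -> j = j') ->
   forall t t', rel (r t) (r t') -> t = t').
Proof.
have [w wP] := choice (fun j => det2_coker (detN j)).
exists (fun t => i (w t.1 t.2) * s t.1)%g; split=> [x|phib_fix s_inj].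
  have [j [q xq]] := s_cover (p x); have [z pz] := p_surj q.
  (* Twisted conjugation by a lift of q moves [x] into the coset of [s j]. *)
  have [v Ev] : exists v, (z^-1 * x * phi z * (s j)^-1)%g = i v.
    apply/ker_p; rewrite !pM !extension_pV p_phi pz xq.
    by rewrite -[- q + _ + _]addrA subrK [p (s j) + q]addrC addKr subrr.
  have [t [y vy]] := (wP j).1 v.
  exists (j, t) => /=; apply: (@reidemeister_rel_trans _ _ _ (i v * s j)%g).
    by exists z; rewrite -Ev mulgVK !mulgA mulgV mul1g mulgK.
  by exists (i y); rewrite extension_twist vy NE mulmxBl mul1mx.
move=> [j t] [j' t'] /= E.
have jj' : j = j'.
  have [q] := extension_rel_base E; rewrite !pM !pi !add0r; exact: s_inj.
rewrite -jj' {j' jj'} in E *.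
have [y] := extension_rel_coset phib_fix E.
by rewrite NE -[y in y - _]mul1mx -mulmxBl => /(wP j).2 ->.
Qed.

End FiniteCokernel.
End Extension.

(** * Integer powers of automorphisms and additive maps of Z^2 *)

Lemma expgz_aut_morph (G H : groupType) (f : aut G) (g : aut H) (h : G -> H) :
  (forall x, h (f x) = g (h x)) ->
  forall k x, h (expgz f k x) = expgz g k (h x).
Proof.
move=> hf; have hfn n x : h ((f ^+ n)%g x) = (g ^+ n)%g (h x).
  by elim: n x => // n IHn x; rewrite !expgS /= hf IHn.
case=> n x /=; first exact: hfn.
by rewrite -[in RHS](autK_inv (f ^+ n.+1)%g x) hfn aut_invK.
Qed.

Lemma expgz_aut_inv (G : groupType) (T : Type) (f : aut G) (h : G -> T) :
  (forall x, h (f x) = h x) -> forall k x, h (expgz f k x) = h x.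
Proof.
move=> hf; have hfn n x : h ((f ^+ n)%g x) = h x.
  by elim: n x => // n IHn x; rewrite expgS /= hf IHn.
case=> n x /=; first exact: hfn.
by rewrite -[in RHS](autK_inv (f ^+ n.+1)%g x) hfn.
Qed.

Lemma expgzV (G : groupType) (x : G) k : (expgz x^-1 k = expgz x (- k))%g.
Proof.
by case: k => [[|n]|n] //=; rewrite expVgn // invgK.
Qed.

Lemma additive_int (V : zmodType) (f : int -> V) :
  (forall x y, f (x + y) = f x + f y) -> forall k, f k = f 1 *~ k.
Proof.
move=> fD; have f0 : f 0 = 0 by apply: (@addrI _ (f 0)); rewrite -fD !addr0.
elim/int_rec => [|n IHn|n IHn]; first by rewrite f0.
  by rewrite -addn1 PoszD fD IHn mulrzDr.
apply: (@addIr _ (f 1)); rewrite -fD -[X in _ = _ + X]mulr1z -mulrzDr.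
by have -> : - n.+1%:Z + 1 = - n%:Z by lia.
Qed.

Lemma additive_cV2 (F : 'cV[int]_2 -> 'cV[int]_2) :
  (forall v w, F (v + w) = F v + F w) ->
  exists M : 'M[int]_2, forall v, F v = M *m v.
Proof.
move=> FD; exists (\matrix_(i, j) F (delta_mx j 0) i 0) => v.
have FZ j k : F (k *: delta_mx j 0) = k *: F (delta_mx j 0).
  have fD (x y : int) :
      F ((x + y) *: delta_mx j 0) = F (x *: delta_mx j 0) + F (y *: delta_mx j 0).
    by rewrite scalerDl FD.
  by rewrite (additive_int fD) scale1r -scaler_int intz.
have Ev : v = v 0 0 *: delta_mx 0 0 + v 1 0 *: delta_mx 1 0.
  apply/matrixP => i j; rewrite (ord1 j) !mxE.
  by elim/ord2_ind: i; rewrite /= ?mulr1 ?mulr0 ?addr0 ?add0r.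
rewrite {1}Ev FD !FZ; apply/matrixP => i j.
by rewrite (ord1 j) mulmx22E !mxE mulrC [v 1 0 * _]mulrC.
Qed.

Lemma expgz_N1 k (v : Z2) :
  expgz (mx_aut unitmx_N1) k v = (if oddz k then - 1 else 1 : int) *: v :> 'cV[int]_2.
Proof.
have pw n (w : Z2) : ((mx_aut unitmx_N1) ^+ n)%g w
    = (if odd n then - 1 else 1 : int) *: w :> 'cV[int]_2.
  elim: n => [|n IHn]; first by rewrite scale1r.
  rewrite expgS /= IHn mulNmx mul1mx -scaleNr.
  by case: (odd n) => /=; rewrite ?opprK.
case: k => n; first exact: pw.
have -> : oddz (Negz n) = odd n.+1 by [].
apply: (can_inj (aut_invK ((mx_aut unitmx_N1) ^+ n.+1)%g)).
rewrite /expgz autK_inv pw scalerA; case: ifP => _; by rewrite ?mulrNN mulr1 scale1r.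
Qed.

Lemma expgz_mx (A : 'M[int]_2) (uA : A \in unitmx) (n : nat) (v : Z2) :
  expgz (mx_aut uA) n v = A ^+ n *m v.
Proof.
elim: n => [|n IHn]; first by rewrite mul1mx.
rewrite /= in IHn *.
by rewrite expgS /= IHn exprS mulmxA.
Qed.

Lemma mulmx_cVP (M N : 'M[int]_2) :
  (forall v : 'cV[int]_2, M *m v = N *m v) -> M = N.
Proof.
move=> MN; apply/matrixP => i j.
by have /colP/(_ i) := MN (delta_mx j 0); rewrite -!colE !mxE.
Qed.

Lemma expgz_mx_sign_eq0 (A : 'M[int]_2) (uA : A \in unitmx) b (s : int) :
    (forall a : algC, eigenvalue (map_mx (intr : int -> algC) A) a ->
      [/\ a \is Num.real, a != 1 & a != -1]) ->
    s ^+ 2 = 1 ->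
    (forall v : Z2, expgz (mx_aut uA) b v = s *: v :> 'cV[int]_2) ->
  b = 0.
Proof.
move=> hA s2.
have neq0 (n : nat) : (0 < n)%N ->
    (forall v : Z2, expgz (mx_aut uA) n v = s *: v :> 'cV[int]_2) -> False.
  move=> n0 As; have /eqP[] := expmx_neq_sign hA n0 s2.
  by apply: mulmx_cVP => v; rewrite mul_scalar_mx -As expgz_mx.
case: b => [[|n] As //|n As]; case: (neq0 n.+1) => // v.
(* If a negative power of A is s I, so is the opposite power, because s^2 = 1. *)
rewrite -{1}[v : 'cV_2]scale1r -[1]s2 expr2 -scalerA -As.
exact: (autK_inv (mx_aut uA ^+ n.+1)%g).
Qed.

(** * Automorphisms of E *)

Lemma int_mul_eq1 (a b : int) : a * b = 1 -> a = 1 \/ a = -1.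
Proof.
move=> ab; have /orP[/eqP|/eqP] : a \is a GRing.unit by apply/unitrPr; exists b.
  by left.
by right.
Qed.

Section GroupE.
Variables (A : 'M[int]_2) (uA : A \in unitmx) (n0 : 'cV[int]_2).
Local Notation E := (sdZ (psi uA n0)).
Local Notation J := (mx_aut unitmx_N1).
Local Notation Aa := (mx_aut uA).

(* A triple (v, k, l) of E stands for v t^k u^l; E_p is the quotient map onto
   E / Z^2, and E_s is a set-theoretic section of it, not a morphism. *)
Definition E_i (v : 'cV[int]_2) : E := ((v, 0), 0).
Definition E_p (x : E) : int * int := (x.1.2, x.2).
Definition E_s (q : int * int) : E := ((0, q.1), q.2).
Definition E_rho (q : int * int) (v : 'cV[int]_2) : 'cV[int]_2 :=
  expgz J q.1 (expgz Aa q.2 v).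

Lemma psi_base (v : Z2) : (Aa v, 0) = psi uA n0 (v, 0).
Proof.
rewrite /= /psi_fun /=; congr pair.
by apply/esym; exact: addr0.
Qed.

Lemma psi_snd x : (psi uA n0 x).2 = x.2.
Proof. by rewrite /= /psi_fun /= (expgz_s2 uA) add0r. Qed.

Lemma E_iD v w : E_i (v + w) = (E_i v * E_i w)%g.
Proof. by []. Qed.

Lemma E_i_inj : injective E_i.
Proof. by move=> v w []. Qed.

Lemma E_pM x y : E_p (x * y)%g = E_p x + E_p y.
Proof.
by congr pair => /=; rewrite (expgz_aut_inv psi_snd).
Qed.

Lemma E_p_s q : E_p (E_s q) = q.
Proof. by case: q. Qed.

Lemma E_p_surj q : exists x, E_p x = q.
Proof. by exists (E_s q); exact: E_p_s. Qed.

Lemma E_ker_p x : E_p x = 0 <-> exists v, x = E_i v.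
Proof.
split=> [|[v ->] //]; case: x => [[v k] l] [/= -> ->].
by exists v.
Qed.

Lemma E_conj x v : (x * E_i v = E_i (E_rho (E_p x) v) * x)%g.
Proof.
case: x => [[w k] l]; rewrite /E_i /E_p /E_rho /=.
have Ax := expgz_aut_morph (f := Aa) (g := psi uA n0) (h := fun v : Z2 => (v, 0) : Z2xN1) psi_base l v.
congr (_, _); last exact: addrC.
rewrite /= -Ax; congr (_, _); last exact: addrC.
exact: addrC.
Qed.

Let psi1 l : expgz (psi uA n0) l 1%g = 1%g := aut1 _.
Let J1 k : expgz J k 1%g = 1%g := aut1 _.

Lemma E_s1D k m : E_s (k + m, 0) = (E_s (k, 0) * E_s (m, 0))%g.
Proof.
congr (_, _); congr (_, _).
by apply/esym; rewrite /= J1; exact: addr0.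
Qed.

Lemma E_s2D k m : E_s (0, k + m) = (E_s (0, k) * E_s (0, m))%g.
Proof.
by congr (_, _); rewrite /= psi1 mulg1.
Qed.

Lemma E_decomp x : x = (E_i x.1.1 * E_s (x.1.2, 0) * E_s (0, x.2))%g.
Proof.
case: x => [[v k] l].
have -> : (E_i v * E_s (k, 0))%g = ((v, k), 0) :> E.
  by congr (_, _); congr (_, _); rewrite /= ?add0r //; apply: addr0.
congr (_, _); last by rewrite /= add0r.
by rewrite /=; congr (_, _); apply/esym; [rewrite J1; apply: addr0 | apply: addr0].
Qed.

(* Conjugation by t inverts Z^2, so 2Z^2 consists of commutators and dies in
   the abelian quotient Z^2 of E. *)
Lemma E_aut_i (phi : aut E) v : E_p (phi (E_i v)) = 0.
Proof.
pose t := E_s (1, 0).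
have := congr1 (E_p \o phi) (E_conj t v); rewrite /= !autM !E_pM.
have -> : E_rho (E_p t) v = - v.
  by rewrite /E_rho E_p_s expgz_N1 scaleN1r.
have -> : E_i (- v) = ((E_i v)^-1)%g by rewrite (extension_iN E_iD).
rewrite autV (extension_pV E_pM) addrC => /addIr.
by case: (E_p _) => a b [] ? ?; congr (_, _); lia.
Qed.

Lemma E_aut_p (phi : aut E) x :
  E_p (phi x) = E_p (phi (E_s (1, 0))) *~ x.1.2 + E_p (phi (E_s (0, 1))) *~ x.2.
Proof.
rewrite {1}[x]E_decomp !autM !E_pM E_aut_i add0r; congr (_ + _).
  by apply: (additive_int (f := fun k => E_p (phi (E_s (k, 0))))) => k m;
    rewrite E_s1D autM E_pM.
by apply: (additive_int (f := fun k => E_p (phi (E_s (0, k))))) => k m;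
  rewrite E_s2D autM E_pM.
Qed.

Lemma E_aut_mx (phi : aut E) : exists M, forall v, phi (E_i v) = E_i (M *m v).
Proof.
have phiE v : phi (E_i v) = E_i (phi (E_i v)).1.1.
  by have /E_ker_p [w ->] := E_aut_i phi v.
have [v w|M ME] := @additive_cV2 (fun v => (phi (E_i v)).1.1); last first.
  by exists M => v; rewrite phiE ME.
by apply: E_i_inj; rewrite [RHS]E_iD -!phiE E_iD autM.
Qed.

Lemma E_aut_rho (phi : aut E) M : (forall v, phi (E_i v) = E_i (M *m v)) ->
  forall x v, E_rho (E_p (phi x)) (M *m v) = M *m E_rho (E_p x) v.
Proof.
move=> ME x v; apply: E_i_inj; apply: (@mulIg _ (phi x)).
by rewrite -E_conj -!ME -!autM E_conj.
Qed.

Lemma E_aut_unitmx (phi : aut E) M : (forall v, phi (E_i v) = E_i (M *m v)) ->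
  M \in unitmx.
Proof.
move=> ME; have [M' M'E] := E_aut_mx (aut_inv phi).
suff /mulmx1_unit [] : M *m M' = 1%:M by [].
apply: mulmx_cVP => v; apply: E_i_inj.
by rewrite -mulmxA -ME -M'E autK_inv mul1mx.
Qed.

Hypothesis hA : forall a : algC, eigenvalue (map_mx (intr : int -> algC) A) a ->
  [/\ a \is Num.real, a != 1 & a != -1].

(** The map induced on E / Z^2 is triangular because t acts on Z^2 by a central matrix, and its
    diagonal entries are units because it is invertible. *)
Lemma E_aut_quotient (phi : aut E) : exists a e f : int,
  [/\ a = 1 \/ a = -1, f = 1 \/ f = -1 &
      forall x, E_p (phi x) = (a * (E_p x).1 + e * (E_p x).2, f * (E_p x).2)].
Proof.
have [M ME] := E_aut_mx phi.
have uM := E_aut_unitmx ME.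
case Et: (E_p (phi (E_s (1, 0)))) => [a b].
case Eu: (E_p (phi (E_s (0, 1)))) => [e f].
(* Since -I commutes with M, phi(t) also acts by -I; it acts by (-1)^a A^b, so A^b is the scalar
   -(-1)^a. *)
have b0 : b = 0.
  apply: (expgz_mx_sign_eq0 (uA := uA) (s := if oddz a then 1 else - 1) hA).
    by case: ifP.
  move=> v; have := E_aut_rho ME (E_s (1, 0)) (invmx M *m (v : 'cV_2)).
  rewrite Et E_p_s /E_rho !expgz_N1 /= mulKVmx //.
  rewrite scaleN1r mulmxN mulKVmx // => /(congr1 ( *:%R (if oddz a then - 1 else 1))).
  by rewrite scalerA; case: (oddz a); rewrite ?mulrNN mulr1 !scale1r ?scaleN1r ?opprK.
have pE x : E_p (phi x) = (a * (E_p x).1 + e * (E_p x).2, f * (E_p x).2).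
  rewrite E_aut_p Et Eu b0; case: x => [[v k] l] /=.
  have scale_pair (c d m : int) : (c, d) *~ m = (c * m, d * m).
    have := additive_int (f := fun m : int => (c * m, d * m)) _ m.
    by rewrite !mulr1 => -> // x y; rewrite !mulrDr.
  by rewrite !scale_pair; congr (_, _); rewrite mul0r; exact: add0r.
(* The preimages of t and u under phi provide inverses of [a] and [f]. *)
exists a, e, f; split=> //.
  have := pE (aut_inv phi (E_s (1, 0))); rewrite autK_inv E_p_s.
  have := pE (aut_inv phi (E_s (0, 1))); rewrite autK_inv E_p_s.
  case: (E_p _) => k l; case: (E_p _) => k' l' /= [_ H1] [H2 H3].
  have l'0 : l' = 0 by move/eqP: H3; rewrite eq_sym mulf_eq0 => /orP [] /eqP; nia.
  rewrite l'0 mulr0 addr0 in H2.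
  exact: int_mul_eq1 (esym H2).
have := pE (aut_inv phi (E_s (0, 1))); rewrite autK_inv E_p_s => -[_ H].
exact: int_mul_eq1 (esym H).
Qed.

End GroupE.

(** * Reidemeister numbers of E *)

Section Main.
Variables (A : 'M[int]_2) (uA : A \in unitmx).
Hypothesis hA : forall a : algC, eigenvalue (map_mx (intr : int -> algC) A) a ->
  [/\ a \is Num.real, a != 1 & a != -1].

(** Multiplying the relation by adj(A) gives M A = s det(A) adj(A) M. Conjugation by M and equality
    of the traces of A and adj(A), which are nonzero, force s det(A) = 1. *)
Lemma reversing_mx_traces (M : 'M[int]_2) (s : int) :
    M \in unitmx -> s ^+ 2 = 1 -> M = s *: (A *m M *m A) ->
  [/\ s = \det A, \tr M = 0 & \tr (A *m M) = 0].
Proof.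
move=> uM s2 ME; have dd : \det A * \det A = 1 by case: (det_unitmx uA) => ->.
have MA : M *m A = (s * \det A) *: ((\tr A *: 1%:M - A) *m M).
  rewrite {2}ME -scalemxAr scalerA !mulmxA mulmx_mxtrace_sub mul_scalar_mx -scalemxAl.
  rewrite !scalerA -[LHS]scale1r; congr (_ *: _).
  by transitivity (s ^+ 2 * (\det A * \det A)); [rewrite s2 dd | ring].
have sd : s * \det A = 1.
  have trA : \tr (invmx M *m (M *m A)) = \tr (invmx M *m (M *m A)) by [].
  move: trA; rewrite {2}MA mulKmx // -scalemxAr mxtraceZ mxtrace_mulC mulmxK //.
  rewrite raddfB /= mxtraceZ mxtrace1 => trA.
  apply: (mulIf (mxtrace_neq0 hA uA)); rewrite mul1r [RHS]trA; congr (_ * _); ring.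
have [trM trAM] : \tr M = 0 /\ \tr (A *m M) = 0.
  apply: mxtrace_eq0_of_reverse; first exact: discriminant_neq0.
  by rewrite MA sd scale1r.
by split=> //; rewrite -[s]mulr1 -dd mulrA sd mul1r.
Qed.

Lemma det_sub_trace0 (N : 'M[int]_2) :
  \tr N = 0 -> \det N = 1 -> \det (1%:M - N) = 2.
Proof. by move=> trN detN; rewrite det_scalar_sub trN detN. Qed.

Lemma int_half (k : int) : exists m, k = (oddz k)%:Z + 2 * m.
Proof.
exists (k %/ 2)%Z.
by rewrite /oddz; lia.
Qed.

(** * A finite Reidemeister number for the semidirect product via A *)

Section GroupH.
Local Notation H := (sdZ (mx_aut uA)).
Variables (M : 'M[int]_2) (uM : M \in unitmx).
Hypothesis ME : M = A *m M *m A.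

Lemma reversing_expgz k (v : Z2) :
  mx_aut uM (expgz (mx_aut uA) k v) = expgz (mx_aut uA) (- k) (mx_aut uM v).
Proof.
rewrite -expgzV; apply: (expgz_aut_morph (h := mx_aut uM)) => {k v} v.
apply: (can_inj (aut_invK (mx_aut uA))); rewrite autK_inv /=.
by rewrite [in RHS]ME !mulmxA.
Qed.

Definition H_aut_fun (x : H) : H := (mx_aut uM x.1, - x.2).

Lemma H_aut_morph : {morph H_aut_fun : x y / (x * y)%g}.
Proof.
move=> [v k] [w m]; congr (_, _); last exact: opprD.
by rewrite [LHS]autM reversing_expgz.
Qed.

Lemma H_aut_bij : bijective H_aut_fun.
Proof.
exists (fun x : H => (aut_inv (mx_aut uM) x.1, - x.2) : H) => -[v k].
  by rewrite /H_aut_fun aut_invK opprK.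
by rewrite /H_aut_fun autK_inv opprK.
Qed.

Definition H_aut : aut H := Aut H_aut_morph H_aut_bij.

(** On the quotient Z the automorphism is -1, whose twisted classes are the parities. The matrices
    over them are M and A M, so four representatives cover the group. *)
Lemma H_not_R_infty : \det A = 1 -> \det M = 1 -> \tr M = 0 -> \tr (A *m M) = 0 ->
  ~ R_infty H.
Proof.
move=> detA detM trM trAM RH.
have : reidemeister_spectrum H (reidemeister_number H_aut) by exists H_aut.
rewrite RH /=.
pose i (v : 'cV[int]_2) : H := (v, 0).
pose p (x : H) : int := x.2.
pose rho (q : int) (v : 'cV[int]_2) : 'cV[int]_2 := expgz (mx_aut uA) q v.
pose s (j : bool) : H := (0, j%:Z).
pose N (j : bool) := if j then A *m M else M.
have iD v w : i (v + w) = (i v * i w)%g by [].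
have i_inj : injective i by move=> v w [].
have pM x y : p (x * y)%g = p x + p y by [].
have p_surj q : exists x, p x = q by exists ((0, q) : H).
have ker_p x : p x = 0 <-> exists v, x = i v.
  split=> [|[v ->] //]; case: x => [v k] /= ->.
  by exists v.
have conj_i x v : (x * i v = i (rho (p x) v) * x)%g.
  by congr (_, _); exact: addrC.
have p_phi x : p (H_aut x) = - p x by [].
have s_cover q : exists j q', q = p (s j) + q' - - q'.
  have [m ->] := int_half q; exists (oddz q), m.
  by rewrite opprK /p /s /=; lia.
have NE j y : rho (p (s j)) (M *m y) = N j *m y.
  by case: j; rewrite /rho /N /= ?mulmxA.
have detN j : \det (1%:M - N j) = 2.
  case: j; apply: det_sub_trace0 => //=.
  by rewrite det_mulmx detA detM.
have phi_i v : H_aut (i v) = i (M *m v) by [].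
have [r [r_cover _]] := extension_representatives iD i_inj pM p_surj ker_p conj_i
  phi_i p_phi s_cover NE detN.
exact: reidemeister_finite r_cover.
Qed.

End GroupH.

(** * Possible Reidemeister numbers for E *)

Section GroupE.
Variable n0 : 'cV[int]_2.
Local Notation E := (sdZ (psi uA n0)).

(** The value 8 is paired with the failure of [R_infty], so one case analysis yields both claims of
    the theorem. *)
Lemma E_reidemeister (phi : aut E) :
  reidemeister_number phi = Infty \/
  reidemeister_number phi = Fin 8 /\ ~ R_infty (sdZ (mx_aut uA)).
Proof.
have [M ME] := E_aut_mx phi; have uM := E_aut_unitmx ME.
have [a [e [f [a1 f1 pE]]]] := E_aut_quotient hA phi.
pose phib (q : int * int) : int * int := (a * q.1 + e * q.2, f * q.2).
have p_phi x : E_p (phi x) = phib (E_p x) := pE x.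
case: f1 => f1.
  left; apply: (extension_infinite_base (@E_pM A uA n0) (@E_p_surj A uA n0) p_phi
    (h := snd) (q := fun n => (0, n%:Z))) => //.
    by move=> q; rewrite /phib f1 /= mul1r.
  by move=> m n [].
case: a1 => a1.
  (* For a = 1 and f = -1, [phib] sends (k, l) to (k + e l, -l) and fixes the functional 2k + e
     l. *)
  left; apply: (extension_infinite_base (@E_pM A uA n0) (@E_p_surj A uA n0) p_phi
    (h := fun q => 2 * q.1 + e * q.2) (q := fun n => (n%:Z, 0))).
  - by move=> [k l] [k' l'] /=; ring.
  - by move=> [k l]; rewrite /phib f1 a1 /=; ring.
  - by move=> m n /=; lia.
have phib_fix q : phib q = q -> q = 0.
  case: q => k l; rewrite /phib a1 f1 /= => -[H1 H2].
  have l0 : l = 0 by lia.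
  by move: H1; rewrite l0 mulr0 => H1; congr (_, _); lia.
pose sgn (k : int) : int := if oddz k then - 1 else 1.
have rhoE (q : int * int) (v : 'cV[int]_2) :
    E_rho uA q v = sgn q.1 *: expgz (mx_aut uA) q.2 v.
  by rewrite /E_rho expgz_N1.
have sgn2 : sgn e ^+ 2 = 1 by rewrite /sgn; case: ifP.
(* Compare the actions of u and phi(u) on Z^2: the latter is (-1)^e A^-1. *)
have MAM : M = sgn e *: (A *m M *m A).
  apply: mulmx_cVP => v; have := E_aut_rho ME (E_s uA n0 (0, 1)) v.
  rewrite p_phi !rhoE E_p_s /phib [_.1]/= [_.2]/= a1 f1 mulr0 add0r !mulr1 scale1r.
  have Aw : A *m expgz (mx_aut uA) (- 1) (M *m v) = M *m v.
    exact: (autK_inv (mx_aut uA)).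
  move/(congr1 (fun w => sgn e *: (A *m w))).
  by rewrite -scalemxAr Aw scalerA -expr2 sgn2 scale1r -scalemxAl !mulmxA.
have [sgnE trM trAM] := reversing_mx_traces uM sgn2 MAM.
have infinite_coset s N := @extension_infinite_coset _ _ _ _ _ (@E_iD A uA n0)
  (@E_i_inj A uA n0) (@E_pM A uA n0) (@E_ker_p A uA n0) (@E_conj A uA n0) phi M phib ME p_phi s N phib_fix.
(* A determinant -1 for M, or else for A M, makes the coset of 1, respectively of u, contribute
   infinitely many classes. *)
case: (det_unitmx uM) => detM; last first.
  by left; apply: (infinite_coset (E_s uA n0 (0, 0)) M).
case: (det_unitmx uA) => detA; last first.
  left; apply: (infinite_coset (E_s uA n0 (0, 1)) (A *m M)) => //.
    by move=> y; rewrite rhoE E_p_s scale1r -mulmxA.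
  by rewrite det_mulmx detM detA.
right; rewrite sgnE detA in MAM.
split; last by apply: (H_not_R_infty uM) => //; rewrite {1}MAM scale1r.
have [e' Ee] : exists e', e = 2 * e'.
  by apply: oddz_double; move: sgnE; rewrite detA /sgn; case: ifP.
pose s (j : bool * bool) := E_s uA n0 ((j.1)%:Z, (j.2)%:Z).
pose N (j : bool * bool) := sgn j.1 *: (if j.2 then A *m M else M).
have s_cover q : exists j q', q = E_p (s j) + q' - phib q'.
  case: q => k l.
  have [k' Ek] := int_half k; have [l' El] := int_half l.
  (* The term e' l' cancels the contribution of e, so that q' - phib q' = (2k', 2l'). *)
  exists (oddz k, oddz l), (k' + e' * l', l').
  rewrite E_p_s /phib a1 f1 Ee {1}Ek {1}El; congr (_, _) => /=; ring.
have s_inj j j' q : E_p (s j) + phib q = E_p (s j') + q -> j = j'.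
  case: j => j1 j2; case: j' => j1' j2'; case: q => k l.
  rewrite !E_p_s /phib a1 f1 Ee => -[/= H1 H2].
  have [l0 ->] : l = 0 /\ j2 = j2' by lia.
  by move: H1; rewrite l0 => H1; congr (_, _); lia.
have NE j y : E_rho uA (E_p (s j)) (M *m y) = N j *m y.
  rewrite rhoE E_p_s /N -scalemxAl; congr (_ *: _).
  by case: j => j1 [] /=; rewrite ?mulmxA.
have detN j : \det (1%:M - N j) = 2.
  (* Trace 0 and determinant 1 both survive a change of sign in size two. *)
  have [tr0 det1] : \tr (if j.2 then A *m M else M) = 0 /\
      \det (if j.2 then A *m M else M) = 1.
    by case: ifP; rewrite // det_mulmx detA detM.
  apply: det_sub_trace0; first by rewrite mxtraceZ tr0 mulr0.
  by rewrite detZ det1 mulr1 /sgn; case: ifP.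
have [r [r_cover r_inj]] := extension_representatives (@E_iD A uA n0)
  (@E_i_inj A uA n0) (@E_pM A uA n0) (@E_p_surj A uA n0) (@E_ker_p A uA n0)
  (@E_conj A uA n0) ME p_phi s_cover NE detN.
rewrite (reidemeister_card r_cover (r_inj phib_fix s_inj)).
by rewrite !card_prod !card_bool.
Qed.

(** The identity attains it: the exponent of u is a conjugacy invariant. *)
Lemma E_spectrum_Infty : reidemeister_spectrum E Infty.
Proof.
exists (aut_one E) => //.
have p_id x : E_p (aut_one E x) = id (E_p x) by [].
by apply: (extension_infinite_base (@E_pM A uA n0) (@E_p_surj A uA n0) p_id
    (h := snd) (q := fun n => (0, n%:Z))) => // m n [].
Qed.

End GroupE.
End Main.

Theorem proposition5p17 (A : 'M[int]_2) (uA : A \in unitmx)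
    (hA : forall a : algC, eigenvalue (map_mx (intr : int -> algC) A) a ->
       [/\ a \is Num.real, a != 1%R & a != (-1)%R])
    (n0 : 'cV[int]_2) :
  (reidemeister_spectrum (sdZ (psi uA n0)) = [set Infty]%classic \/
   reidemeister_spectrum (sdZ (psi uA n0)) = [set Fin 8; Infty]%classic) /\
  (R_infty (sdZ (mx_aut uA)) -> R_infty (sdZ (psi uA n0))).
Proof.
have dich := @E_reidemeister A uA hA n0; have specI := E_spectrum_Infty uA n0.
have RinftyE : (forall phi : aut (sdZ (psi uA n0)), reidemeister_number phi = Infty) ->
    reidemeister_spectrum (sdZ (psi uA n0)) = [set Infty]%classic.
  by move=> inf; apply/seteqP; split=> [_ [phi _ <-]|_ ->].
have [[phi phi8]|no8] := pselect (exists phi : aut (sdZ (psi uA n0)),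
    reidemeister_number phi = Fin 8).
  split.
    right; apply/seteqP; split=> [_ [theta _ <-]|_ [->|->]] //.
      by case: (dich theta) => [->|[-> _]]; [right | left].
    by exists phi.
  by move=> RH; case: (dich phi) => [|[_ /(_ RH)]] //; rewrite phi8.
have inf (phi : aut (sdZ (psi uA n0))) : reidemeister_number phi = Infty.
  by case: (dich phi) => // -[phi8 _]; case: no8; exists phi.
by split=> [|_]; [left|]; exact: RinftyE.
Qed.
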